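(* Let $r_5=\sqrt{\sec(\pi/5)}$ and consider the state $$\Phi_H=\begin{pmatrix} -\cos(\pi/5) & \frac{-r_5^6\sin(\pi/5)}{8(1+r_5^2)} & 0\\ \frac{-r_5^6\sin(\pi/5)}{8(1+r_5^2)} & \cos(\pi/5) & \frac{-r_5^3}{4\sin(\pi/5)}\\ 0&\frac{-r_5^3}{4\sin(\pi/5)}&1\end{pmatrix}$$ of the bipartite pentagon system. With Alice's measurements $\mathcal M_1=\{e_1,\bar e_1\}$, $\mathcal M_2=\{e_5,\bar e_5\}$ and Bob's measurements $\mathcal N_1=\{e_1,\bar e_1\}$, $\mathcal N_2=\{\bar e_2,e_2\}$ (the first listed effect being outcome $+$, the second outcome $-$), the correlation obtained from $\Phi_H$ exhibits Hardy's nonlocality: $$P(+,+|\mathcal M_1\mathcal N_2)=0,\quad P(+,+|\mathcal M_2\mathcal N_1)=0,\quad P(-,-|\mathcal M_2\mathcal N_2)=0,\quad P(+,+|\mathcal M_1\mathcal N_1)=1-\tfrac{4\sqrt5}{10}>0,$$ and this success probability is strictly larger than $\frac{5\sqrt5-11}{2}$, the optimal quantum value of Hardy's success probability.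
   Context: Pentagon model. The elementary state space is the convex hull in $\mathbb R^3$ of the pure states $\omega_i=(r_5\cos\frac{2\pi i}{5},\,r_5\sin\frac{2\pi i}{5},\,1)^{\mathrm T}$, $i=1,\dots,5$. The unit effect is $u=(0,0,1)^{\mathrm T}$; the extremal effects other than $0$ and $u$ are $e_i=\frac{1}{1+r_5^2}(r_5\cos\frac{2\pi i}{5},\,r_5\sin\frac{2\pi i}{5},\,1)^{\mathrm T}$ and $\bar e_i=u-e_i$. Bipartite (maximal tensor product) states are the real $3\times3$ matrices $\Phi$ with $u^{\mathrm T}\Phi u=1$ and $e_i^{\mathrm T}\Phi e_j\ge 0$ for all $i,j$. The joint probability of Alice's effect $E$ and Bob's effect $F$ on $\Phi$ is $E^{\mathrm T}\Phi F$. That $\frac{5\sqrt5-11}{2}\approx0.0902$ is the maximal value of $P(+,+|\mathcal M_1\mathcal N_1)$ for quantum correlations satisfying the three zero conditions is a known result which may be taken as given; the claim is the comparison with this number. *)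

(* Defs.v *)
From HB Require Import structures.
From mathcomp Require Import all_boot all_order all_algebra.
From mathcomp Require Import all_classical all_reals all_analysis.

Set Implicit Arguments.
Unset Strict Implicit.
Unset Printing Implicit Defensive.

Import Order.TTheory GRing.Theory Num.Theory.

Local Open Scope ring_scope.

Definition col3 (R : realType) (a b c : R) : 'cV[R]_3 :=
  \col_(k < 3) [:: a; b; c]`_k.

(* sec (pi / 5) is written as the inverse of the cosine *)
Definition r5 (R : realType) : R := Num.sqrt (cos (pi / 5))^-1.

Definition unit_effect (R : realType) : 'cV[R]_3 := col3 0 0 1.

(* e_i is meant for 1 <= i <= 5; it is 5-periodic in i *)
Definition effect (R : realType) (i : nat) : 'cV[R]_3 :=
  (1 + r5 R ^+ 2)^-1 *:
    col3 (r5 R * cos (2 * pi * i%:R / 5)) (r5 R * sin (2 * pi * i%:R / 5)) 1.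

Definition coeffect (R : realType) (i : nat) : 'cV[R]_3 :=
  unit_effect R - effect R i.

(* joint probability E^T Phi F, read off from a 1 x 1 matrix *)
Definition joint (R : realType) (Phi : 'M[R]_3) (E F : 'cV[R]_3) : R :=
  (E^T *m Phi *m F) 0 0.

(* maximal tensor product of two pentagon systems *)
Definition bipartite_state (R : realType) (Phi : 'M[R]_3) : Prop :=
  joint Phi (unit_effect R) (unit_effect R) = 1 /\
  forall i j : nat, (1 <= i <= 5)%N -> (1 <= j <= 5)%N ->
    0 <= joint Phi (effect R i) (effect R j).

Variant outcome := plus | minus.

Definition measurement (R : realType) := outcome -> 'cV[R]_3.

(* {E, F}: the first listed effect is the outcome plus *)
Definition meas (R : realType) (E F : 'cV[R]_3) : measurement R :=
  fun o => match o with plus => E | minus => F end.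

(* P(a, b | M N) *)
Definition prob (R : realType) (Phi : 'M[R]_3) (a b : outcome)
    (M N : measurement R) : R :=
  joint Phi (M a) (N b).

Definition PhiH (R : realType) : 'M[R]_3 :=
  let r := r5 R in
  let c := cos (pi / 5) in
  let s := sin (pi / 5) in
  let x := - r ^+ 6 * s / (8 * (1 + r ^+ 2)) in
  let y := - r ^+ 3 / (4 * s) in
  \matrix_(i < 3, j < 3)
    (nth [::] [:: [:: - c; x; 0];
                  [:: x;   c; y];
                  [:: 0;   y; 1]] i)`_j.

(* Main.v *)
Require Import Defs.
From HB Require Import structures.
From mathcomp Require Import all_boot all_order all_algebra.
From mathcomp Require Import all_classical all_reals all_analysis.
From mathcomp Require Import ring lra.

(** Write c = cos(pi/5), s = sin(pi/5) and q = sqrt 5.  Since 3 pi/5 = pi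
    - 2 pi/5, equating sin(3 pi/5) and sin(2 pi/5) gives 4 c^2 = 2 c + 1,
    hence c = (1 + q)/4 and r5^2 = 1/c = q - 1.  The vertices of the pentagon
    have cosines in Q(q) and sines of the form s t with t in Q(q); the off-
    diagonal entries of the state are such that s only occurs squared in E^T
    Phi F.  So all the joint probabilities lie in Q(q) and can be compared
    there. *)

Import Order.TTheory GRing.Theory Num.Theory.

Local Open Scope ring_scope.

Lemma sqrt5_sqr (R : realType) : Num.sqrt (5 : R) ^+ 2 = 5.
Proof. by rewrite sqr_sqrtr. Qed.

(** On the effects, the joint probabilities are polynomials of degree at most three in [Num.sqrt 5];
    this and [sqrt5_sqr] make them affine, within reach of [lra]. *)
Lemma sqrt5_cube (R : realType) : Num.sqrt (5 : R) ^+ 3 = 5 * Num.sqrt 5.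
Proof. by rewrite exprSr sqrt5_sqr. Qed.

Lemma sqrt5_bounds (R : realType) :
  559 / 250 < Num.sqrt (5 : R) /\ Num.sqrt (5 : R) < 2237 / 1000.
Proof.
have h := sqrt5_sqr R; have h0 := sqrtr_ge0 (5 : R).
by split; nra.
Qed.

Lemma sin_pi5_gt0 (R : realType) : 0 < sin (pi / 5 : R).
Proof. by have hpi := pi_gt0 R; apply: sin_gt0_pi; lra. Qed.

Lemma cos_pi5_gt0 (R : realType) : 0 < cos (pi / 5 : R).
Proof.
have hpi := pi_gt0 R; apply: cos_gt0_pihalf.
by apply/andP; split; lra.
Qed.

Lemma cos_pi5 (R : realType) : cos (pi / 5 : R) = (1 + Num.sqrt 5) / 4.
Proof.
set c := cos _; pose s := sin (pi / 5 : R).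
have s0 : 0 < s := sin_pi5_gt0 R.
have c0 : 0 < c := cos_pi5_gt0 R.
have cs : c ^+ 2 + s ^+ 2 = 1 by exact: cos2Dsin2.
have sin_triple : sin (pi / 5 *+ 2 + pi / 5 : R) = sin (pi / 5 *+ 2).
  have -> : pi / 5 *+ 2 + pi / 5 = - (pi / 5 *+ 2) + pi :> R by field.
  by rewrite sinDpi sinN opprK.
move: sin_triple; rewrite sinD sin_mulr2n cos_mulr2n -/c -/s => h.
have hc : 4 * c ^+ 2 = 2 * c + 1 by apply: (mulfI (lt0r_neq0 s0)); lra.
have hq := sqrt5_sqr R; have q0 := sqrtr_ge0 (5 : R).
(* Selects the positive root of the quadratic: c > 0 gives 4 c^2 > 1, so c > 1/2. *)
have c2 : 0 < 4 * c - 1 by nra.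
suff -> : Num.sqrt 5 = 4 * c - 1 by field.
have -> : 5 = (4 * c - 1) ^+ 2 :> R by lra.
by rewrite sqrtr_sqr ger0_norm ?ltW.
Qed.

Lemma sin_pi5_sqr (R : realType) :
  sin (pi / 5 : R) ^+ 2 = (5 - Num.sqrt 5) / 8.
Proof.
have := cos2Dsin2 (pi / 5 : R); rewrite cos_pi5 => h.
by have hq := sqrt5_sqr R; lra.
Qed.

Lemma r5_gt0 (R : realType) : 0 < r5 R.
Proof. by rewrite sqrtr_gt0 invr_gt0 cos_pi5_gt0. Qed.

Lemma r5_sqr (R : realType) : r5 R ^+ 2 = Num.sqrt 5 - 1.
Proof.
rewrite sqr_sqrtr ?invr_ge0 ?ltW ?cos_pi5_gt0 //.
have c0 := cos_pi5_gt0 R; apply: (mulfI (lt0r_neq0 c0)).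
rewrite mulfV ?gt_eqF // cos_pi5.
by have hq := sqrt5_sqr R; lra.
Qed.

Lemma joint_PhiH (R : realType) (a b c a' b' c' : R) :
  let r := r5 R in
  let s := sin (pi / 5) in
  joint (PhiH R) (col3 a b c) (col3 a' b' c') =
    cos (pi / 5) * (b * b' - a * a')
    - r ^+ 6 * s / (8 * (1 + r ^+ 2)) * (a * b' + b * a')
    - r ^+ 3 / (4 * s) * (b * c' + c * b') + c * c'.
Proof.
move=> r s; rewrite /joint /PhiH /col3 -/r -/s.
by rewrite !mxE !big_ord_recl !big_ord0 !mxE !big_ord_recl !big_ord0 !mxE /=; ring.
Qed.

Lemma jointZl (R : realType) (Phi : 'M[R]_3) (x : R) (E F : 'cV[R]_3) :
  joint Phi (x *: E) F = x * joint Phi E F.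
Proof. by rewrite /joint [(x *: E)^T]linearZ /= -!scalemxAl mxE. Qed.

Lemma jointZr (R : realType) (Phi : 'M[R]_3) (x : R) (E F : 'cV[R]_3) :
  joint Phi E (x *: F) = x * joint Phi E F.
Proof. by rewrite /joint -scalemxAr mxE. Qed.

Lemma jointBl (R : realType) (Phi : 'M[R]_3) (E E' F : 'cV[R]_3) :
  joint Phi (E - E') F = joint Phi E F - joint Phi E' F.
Proof. by rewrite /joint [(E - E')^T]linearB /= !mulmxBl mxE [X in _ + X]mxE. Qed.

Lemma jointBr (R : realType) (Phi : 'M[R]_3) (E F F' : 'cV[R]_3) :
  joint Phi E (F - F') = joint Phi E F - joint Phi E F'.
Proof. by rewrite /joint mulmxBr mxE [X in _ + X]mxE. Qed.

(** For a vertex, [a] is the cosine of its angle and [t] its sine in units of sin(pi/5). *)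
Definition pentagon_vec {R : realType} (a t : R) : 'cV[R]_3 :=
  (1 + r5 R ^+ 2)^-1 *: col3 (r5 R * a) (r5 R * (sin (pi / 5) * t)) 1.

(** As 1 + r5^2 = q, the centre of the pentagon of effects is u / q; hence coeffects are covered by
    the same bilinear formula as effects. *)
Lemma unit_effectE (R : realType) :
  unit_effect R = Num.sqrt 5 *: pentagon_vec 0 0.
Proof.
have q0 : Num.sqrt 5 != 0 :> R by rewrite gt_eqF // sqrtr_gt0.
rewrite /pentagon_vec r5_sqr addrCA subrr addr0 scalerA divff // scale1r.
by rewrite !mulr0.
Qed.

Lemma joint_pentagon_vec (R : realType) (a t b w : R) :
  let q := Num.sqrt 5 in
  joint (PhiH R) (pentagon_vec a t) (pentagon_vec b w) =
    (1 - a * b + (5 - q) / 8 * (t * w) - (5 * q - 11) / 4 * (a * w + t * b)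
     - (3 - q) / 2 * (t + w)) / 5.
Proof.
move=> q; rewrite /pentagon_vec jointZl jointZr joint_PhiH.
set r := r5 R; set c := cos _; set s := sin _.
have s0 : s != 0 by rewrite gt_eqF // sin_pi5_gt0.
have hq : q ^+ 2 = 5 by exact: sqrt5_sqr.
have q0 : q != 0 by rewrite gt_eqF // sqrtr_gt0.
have hs : s ^+ 2 = (5 - q) / 8 by exact: sin_pi5_sqr.
have hr : r ^+ 2 = q - 1 by exact: r5_sqr.
have hc : c = (1 + q) / 4 by exact: cos_pi5.
have -> : 1 + r ^+ 2 = q by rewrite hr; ring.
have h1 : c * r ^+ 2 = 1 by rewrite hc hr; lra.
have h3 : r ^+ 4 = 2 * (3 - q) by rewrite (exprM r 2 2) hr; lra.
(* The value is 50 - 22 q; the factor q is pulled out to cancel against the denominator 8 q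
   below. *)
have h2 : r ^+ 8 * s ^+ 2 = 2 * q * (5 * q - 11).
  by rewrite (exprM r 4 2) h3 hs; field: hq.
(* The matrix entry containing s meets exactly one sine, giving s^2, and the entry containing 1/s
   cancels one; what remains is grouped into the quantities evaluated above. *)
transitivity ((1 - (c * r ^+ 2) * (a * b) + (c * r ^+ 2) * s ^+ 2 * (t * w)
    - r ^+ 8 * s ^+ 2 / (8 * q) * (a * w + t * b)
    - r ^+ 4 / 4 * (t + w)) / q ^+ 2).
  by field; rewrite q0 s0.
by rewrite h1 h2 h3 hs hq; field; rewrite q0.
Qed.

Lemma effect_pentagon (R : realType) :
  let q := Num.sqrt 5 : R in
  [/\ effect R 1 = pentagon_vec ((q - 1) / 4) ((1 + q) / 2),
      effect R 2 = pentagon_vec (- (1 + q) / 4) 1,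
      effect R 3 = pentagon_vec (- (1 + q) / 4) (- 1),
      effect R 4 = pentagon_vec ((q - 1) / 4) (- (1 + q) / 2)
    & effect R 5 = pentagon_vec 1 0].
Proof.
move=> q.
have hq : q ^+ 2 = 5 by exact: sqrt5_sqr.
have hc := cos_pi5 R; rewrite -/q in hc.
have c2 : cos (pi / 5 *+ 2) = (q - 1) / 4 :> R by rewrite cos_mulr2n hc; lra.
have s2 : sin (pi / 5 *+ 2) = sin (pi / 5) * ((1 + q) / 2) :> R.
  by rewrite sin_mulr2n hc; lra.
(* Every angle becomes 0 or plus or minus pi/5 or 2 pi/5, up to a shift by pi or 2 pi. *)
have a1 : 2 * pi * 1%:R / 5 = pi / 5 *+ 2 :> R by field.
have a2 : 2 * pi * 2%:R / 5 = - (pi / 5) + pi :> R by field.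
have a3 : 2 * pi * 3%:R / 5 = pi / 5 + pi :> R by field.
have a4 : 2 * pi * 4%:R / 5 = - (pi / 5 *+ 2) + pi *+ 2 :> R by field.
have a5 : 2 * pi * 5%:R / 5 = pi *+ 2 :> R by field.
by split; rewrite /effect /pentagon_vec ?a1 ?a2 ?a3 ?a4 ?a5;
  rewrite ?cos2pi ?sin2pi ?cosD2pi ?sinD2pi ?cosDpi ?sinDpi ?cosN ?sinN
    ?c2 ?s2 ?hc; congr (_ *: col3 (_ * _) (_ * _) _); field.
Qed.

Lemma PhiH_state (R : realType) : bipartite_state (PhiH R).
Proof.
have hq := sqrt5_sqr R; have hq3 := sqrt5_cube R.
have [q_lb q_ub] := sqrt5_bounds R.
have [e1 e2 e3 e4 e5] := effect_pentagon R.
split; first by rewrite unit_effectE jointZl jointZr joint_pentagon_vec; lra.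
(* Indices 0 and above 5 contradict the range hypotheses, leaving 25 sign checks. *)
by move=> [|[|[|[|[|[|i]]]]]] [|[|[|[|[|[|j]]]]]] // _ _;
  rewrite ?e1 ?e2 ?e3 ?e4 ?e5 joint_pentagon_vec; lra.
Qed.

Theorem mainTheorem11 (R : realType) :
  let M1 := meas (effect R 1) (coeffect R 1) in
  let M2 := meas (effect R 5) (coeffect R 5) in
  let N1 := meas (effect R 1) (coeffect R 1) in
  let N2 := meas (coeffect R 2) (effect R 2) in
  bipartite_state (PhiH R) /\
  prob (PhiH R) plus plus M1 N2 = 0 /\
  prob (PhiH R) plus plus M2 N1 = 0 /\
  prob (PhiH R) minus minus M2 N2 = 0 /\
  prob (PhiH R) plus plus M1 N1 = 1 - 4 * Num.sqrt 5 / 10 /\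
  0 < prob (PhiH R) plus plus M1 N1 /\
  (5 * Num.sqrt 5 - 11) / 2 < prob (PhiH R) plus plus M1 N1.
Proof.
move=> M1 M2 N1 N2; split; first exact: PhiH_state.
have hq := sqrt5_sqr R; have hq3 := sqrt5_cube R.
have [q_lb q_ub] := sqrt5_bounds R.
have [e1 e2 _ _ e5] := effect_pentagon R.
have p11 : prob (PhiH R) plus plus M1 N1 = 1 - 4 * Num.sqrt 5 / 10.
  by rewrite /prob /= e1 joint_pentagon_vec; lra.
rewrite p11 /prob /= /coeffect e1 e2 e5 jointBl jointBr unit_effectE.
(* The explicit scalar targets the unit effects, not the scaling inside [pentagon_vec]. *)
rewrite (jointZl _ _ (Num.sqrt 5)) (jointZr _ _ (Num.sqrt 5)) !joint_pentagon_vec.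
(* Beating the quantum value means q < 65/29, about 2.2414; the bound 2.237 suffices. *)
by do ![split]; lra.
Qed.
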